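(* In each of the three cases A, B, C described in the context, if $\operatorname{rank}\mathfrak g\le\operatorname{rank}K$, then the surjective homomorphism $\phi:U(\mathfrak g)\to\mathcal D(V)^K$ is an isomorphism.
   Context: $F$ is an algebraically closed field of characteristic zero. $M_{a,b}$ denotes $a\times b$ matrices over $F$. Consider the following pairs $(K,V)$ with $K$ acting linearly on $V$: Case A: $K=GL_k(F)$, $V=M_{p,k}\times M_{k,q}$, $g\cdot(a,b)=(ag^{-1},gb)$; $\mathfrak g=\mathfrak{gl}_{p+q}$ (set $n=p+q$). Case B: $K=O_k(F)$, $V=M_{k,n}$, $g\cdot a=ga$; $\mathfrak g=\mathfrak{sp}_{2n}$. Case C: $K=Sp_{2k}(F)$, $V$ the space of $2k\times n$ matrices, $g\cdot a=ga$; $\mathfrak g=\mathfrak{so}_{2n}$. $\mathcal D(V)$ is the algebra of polynomial-coefficient differential operators on $V$, with the induced $K$-action, and $\mathcal D(V)^K$ its subalgebra of $K$-invariants. In each case (Howe duality) the $K$-invariant operators of degree at most 2 in the Bernstein filtration contain a Lie subalgebra isomorphic to $\mathfrak g$ which generates $\mathcal D(V)^K$ as an associative algebra; this gives a surjective algebra homomorphism $\phi:U(\mathfrak g)\to\mathcal D(V)^K$ mapping $\mathfrak g$ onto that Lie subalgebra. *)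

(* Defs.v *)
From HB Require Import structures.
From mathcomp Require Import all_boot all_order all_algebra.
From mathcomp Require Import mpoly.

Set Implicit Arguments.
Unset Strict Implicit.
Unset Printing Implicit Defensive.

Import GRing.Theory.
Local Open Scope ring_scope.

(* Polynomial-coefficient differential operators on V = F^T,           *)
(* T a finite type of coordinates.  D(V) is realized (faithfully, in   *)
(* characteristic 0) as the algebra of maps on the polynomial ring     *)
(* F[x_t | t in T] generated by the multiplications x_t and the        *)
(* partial derivatives d_t; composition is the product.                *)
Section Ops.
Variables (F : fieldType) (T : finType).

Definition pol := {mpoly F[#|T|]}.
Definition op := pol -> pol.

Definition xop (t : T) : op := fun f => 'X_(enum_rank t) * f.
Definition dop (t : T) : op := fun f => mderiv (enum_rank t) f.
End Ops.

(* Universal enveloping algebra, via its universal property.           *)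
(* term X = free (unital, associative) algebra expressions over the    *)
(* generator set X.  U(g) is the quotient of the free algebra on the   *)
(* set g by linearity and the relations u v - v u = [u,v]; two terms   *)
(* are equal in U(g) iff they have equal values under every Lie        *)
(* homomorphism g -> A into an associative F-algebra A.                *)
Inductive term (F : Type) (X : Type) : Type :=
| tgen of X
| tone
| tadd of term F X & term F X
| tmul of term F X & term F X
| tscale of F & term F X.

Arguments tone {F X}.

Fixpoint term_over (F X : Type) (P : X -> Prop) (t : term F X) : Prop :=
  match t with
  | tgen x => P x
  | tone => True
  | tadd s u => term_over P s /\ term_over P u
  | tmul s u => term_over P s /\ term_over P u
  | tscale _ s => term_over P s
  end.

Fixpoint aeval (F : pzRingType) (A : algType F) (X : Type) (f : X -> A)
    (t : term F X) : A :=
  match t with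
  | tgen x => f x
  | tone => 1
  | tadd s u => aeval f s + aeval f u
  | tmul s u => aeval f s * aeval f u
  | tscale c s => c *: aeval f s
  end.

Fixpoint oeval (F : fieldType) (T : finType) (X : Type) (f : X -> op F T)
    (t : term F X) : op F T :=
  match t with
  | tgen x => f x
  | tone => fun p => p
  | tadd s u => fun p => oeval f s p + oeval f u p
  | tmul s u => fun p => oeval f s (oeval f u p)
  | tscale c s => fun p => c *: oeval f s p
  end.

Definition is_lie_hom (F : pzRingType) (m : nat) (A : algType F)
    (P : 'M[F]_m -> Prop) (f : 'M[F]_m -> A) : Prop :=
  (forall (c : F) (X Y : 'M[F]_m), P X -> P Y -> f (c *: X + Y) = c *: f X + f Y)
  /\ (forall X Y : 'M[F]_m, P X -> P Y ->
        f (X *m Y - Y *m X) = f X * f Y - f Y * f X).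

Definition U_injective (F : fieldType) (T : finType) (m : nat)
    (P : 'M[F]_m -> Prop) (phi : 'M[F]_m -> op F T) : Prop :=
  forall s t : term F 'M[F]_m, term_over P s -> term_over P t ->
    oeval phi s = oeval phi t ->
    forall (A : algType F) (f : 'M[F]_m -> A), is_lie_hom P f ->
      aeval f s = aeval f t.

Section Cases.
Variable F : fieldType.

Definition gl (m : nat) : 'M[F]_m -> Prop := fun _ => True.

Definition Jsp (n : nat) : 'M[F]_(n + n) := block_mx 0 1%:M (- 1%:M) 0.
Definition sp (n : nat) : 'M[F]_(n + n) -> Prop :=
  fun X => X^T *m Jsp n + Jsp n *m X = 0.

Definition Theta (n : nat) : 'M[F]_(n + n) := block_mx 0 1%:M 1%:M 0.
Definition so (n : nat) : 'M[F]_(n + n) -> Prop :=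
  fun X => X^T *m Theta n + Theta n *m X = 0.

(* Case A: V = M_{p,k} x M_{k,q}; coordinates a_{i,alpha} = inl (alpha,i),
   b_{alpha,j} = inr (alpha,j).  After the partial Fourier transform
   z_{alpha,i} = d/da_{i,alpha}, dz_{alpha,i} = -a_{i,alpha} (i <= p),
   z_{alpha,p+j} = b_{alpha,j}, dz_{alpha,p+j} = d/db_{alpha,j},
   E_{rs} |-> sum_alpha z_{alpha,r} dz_{alpha,s}. *)
Definition VA (p q k : nat) := (('I_k * 'I_p) + ('I_k * 'I_q))%type.

Definition zA (p q k : nat) (al : 'I_k) (r : 'I_(p + q)) : op F (VA p q k) :=
  match split r with
  | inl i => dop (F:=F) (inl (al, i))
  | inr j => xop (F:=F) (inr (al, j))
  end.
Definition dzA (p q k : nat) (al : 'I_k) (r : 'I_(p + q)) : op F (VA p q k) :=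
  match split r with
  | inl i => fun f => - xop (F:=F) (inl (al, i)) f
  | inr j => dop (F:=F) (inr (al, j))
  end.
Definition phiA (p q k : nat) (X : 'M[F]_(p + q)) : op F (VA p q k) :=
  fun f => \sum_(r < p + q) \sum_(s < p + q)
             X r s *: \sum_(al < k) zA al r (dzA al s f).

(* Case B: V = M_{k,n}, coordinates x_{alpha,i} = (alpha,i);
   w_{alpha,i} = x_{alpha,i}, w_{alpha,n+i} = d/dx_{alpha,i};
   X |-> 1/2 sum_alpha sum_{a,b} (X J)_{ab} w_{alpha,a} w_{alpha,b}
   (Weyl-symmetric quadratics; X J is symmetric for X in sp_{2n}). *)
Definition VB (n k : nat) := ('I_k * 'I_n)%type.

Definition wB (n k : nat) (al : 'I_k) (a : 'I_(n + n)) : op F (VB n k) :=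
  match split a with
  | inl i => xop (F:=F) (al, i)
  | inr i => dop (F:=F) (al, i)
  end.
Definition phiB (n k : nat) (X : 'M[F]_(n + n)) : op F (VB n k) :=
  fun f => 2^-1 *: \sum_(al < k) \sum_(a < n + n) \sum_(b < n + n)
             (X *m Jsp n) a b *: wB al a (wB al b f).

(* Case C: V = 2k x n matrices, coordinates x_{alpha,i} = (alpha,i),
   omega = [[0, I], [-I, 0]] the symplectic form preserved by Sp_{2k},
   eta = omega^{-1} = - omega;
   w_{alpha,i} = x_{alpha,i}, w_{alpha,n+i} = sum_beta eta_{alpha beta} d/dx_{beta,i};
   X |-> 1/2 sum_{alpha,beta} omega_{alpha beta}
               sum_{a,b} (X Theta)_{ab} w_{alpha,a} w_{beta,b}. *)
Definition VC (n k : nat) := ('I_(k + k) * 'I_n)%type.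

Definition omega (k : nat) : 'M[F]_(k + k) := block_mx 0 1%:M (- 1%:M) 0.

Definition wC (n k : nat) (al : 'I_(k + k)) (a : 'I_(n + n)) : op F (VC n k) :=
  match split a with
  | inl i => xop (F:=F) (al, i)
  | inr i => fun f => \sum_(be < k + k) (- omega k) al be *: dop (F:=F) (be, i) f
  end.
Definition phiC (n k : nat) (X : 'M[F]_(n + n)) : op F (VC n k) :=
  fun f => 2^-1 *: \sum_(al < k + k) \sum_(be < k + k)
             omega k al be *: \sum_(a < n + n) \sum_(b < n + n)
               (X *m Theta n) a b *: wC al a (wC be b f).
End Cases.

Arguments gl : clear implicits.
Arguments sp : clear implicits.
Arguments so : clear implicits.
Arguments phiA : clear implicits.
Arguments phiB : clear implicits.
Arguments phiC : clear implicits.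

(* Main.v *)
Require Import Defs.
From HB Require Import structures.
From mathcomp Require Import all_boot all_order all_algebra.
From mathcomp Require Import boolp ring zify.
From mathcomp Require Import mpoly.

Set Implicit Arguments.
Unset Strict Implicit.
Unset Printing Implicit Defensive.

Import GRing.Theory.
Local Open Scope ring_scope.

(** Ordered monomials in a basis of [g] span [U(g)] (the elementary half of
    PBW), so a relation in [U(g)] becomes a polynomial [p] in the basis elements.
    If [p] has degree [d] and acts by zero on [F[V]], then so does its image
    under [ad y] iterated [2 d] times, for [y] any linear combination of the
    coordinates and the partial derivatives.  Each [phi X] being quadratic, this
    image is the scalar [(2 d)!] times the top-degree part of [p] evaluated at
    the moment map of the point of [V + V*] given by [y].  The rank hypothesis
    makes the moment map onto [g*]: every matrix is [Z^T D] in case A, every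
    symmetric matrix is [V^T V] in case B and every alternating matrix is
    [V^T omega V] in case C, as soon as there are enough rows.  Hence the
    top-degree part of [p] vanishes identically, and [p = 0]. *)

(** * The algebra of linear operators *)

#[local] Obligation Tactic := idtac.

Section LinearOperators.
Variables (F : fieldType) (V : lalgType F).

Record linop := LinOp { linop_fun :> V -> V; linop_linear : linear linop_fun }.

Lemma linopP (f g : linop) : f =1 g -> f = g.
Proof.
case: f g => f fl [g gl] /= /funext fg; rewrite {}fg in fl *.
by congr LinOp; exact: Prop_irrelevance.
Qed.

HB.instance Definition _ := gen_eqMixin linop.
HB.instance Definition _ := gen_choiceMixin linop.

HB.instance Definition _ (f : linop) :=
  GRing.isLinear.Build F V V *:%R (linop_fun f) (linop_linear f).

Program Definition linop0 := @LinOp (fun _ => 0) _.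
Next Obligation. by move=> c u v; rewrite scaler0 addr0. Qed.
Program Definition linop1 := @LinOp (fun v => v) _.
Next Obligation. by []. Qed.
Program Definition linop_opp (f : linop) := @LinOp (fun v => - f v) _.
Next Obligation. by move=> f c u v; rewrite linearP opprD scalerN. Qed.
Program Definition linop_add (f g : linop) := @LinOp (fun v => f v + g v) _.
Next Obligation.
by move=> f g c u v; rewrite !linearP scalerDr addrACA.
Qed.
Program Definition linop_mul (f g : linop) := @LinOp (fun v => f (g v)) _.
Next Obligation. by move=> f g c u v; rewrite !linearP. Qed.
Program Definition linop_scale (c : F) (f : linop) := @LinOp (fun v => c *: f v) _.
Next Obligation.
by move=> c f d u v; rewrite linearP scalerDr !scalerA mulrC.
Qed.

Program Definition linop_zmod :=
  @GRing.isZmodule.Build linop linop0 linop_opp linop_add _ _ _ _.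
Next Obligation. by move=> f g h; apply: linopP => v /=; rewrite addrA. Qed.
Next Obligation. by move=> f g; apply: linopP => v /=; rewrite addrC. Qed.
Next Obligation. by move=> f; apply: linopP => v /=; rewrite add0r. Qed.
Next Obligation. by move=> f; apply: linopP => v /=; rewrite addNr. Qed.
HB.instance Definition _ := linop_zmod.

Program Definition linop_ring :=
  @GRing.Zmodule_isNzRing.Build linop linop1 linop_mul _ _ _ _ _ _.
Next Obligation. by move=> f g h; apply: linopP. Qed.
Next Obligation. by move=> f; apply: linopP. Qed.
Next Obligation. by move=> f; apply: linopP. Qed.
Next Obligation. by move=> f g h; apply: linopP. Qed.
Next Obligation. by move=> f g h; apply: linopP => v /=; rewrite linearD. Qed.
Next Obligation.
by apply/eqP => /(congr1 (fun f : linop => f 1)) /eqP; rewrite oner_eq0.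
Qed.
HB.instance Definition _ := linop_ring.

Program Definition linop_lmod :=
  @GRing.Zmodule_isLmodule.Build F linop linop_scale _ _ _ _.
Next Obligation. by move=> a b f; apply: linopP => v /=; rewrite scalerA. Qed.
Next Obligation. by move=> f; apply: linopP => v /=; rewrite scale1r. Qed.
Next Obligation. by move=> a f g; apply: linopP => v /=; rewrite scalerDr. Qed.
Next Obligation. by move=> f a b; apply: linopP => v /=; rewrite scalerDl. Qed.
HB.instance Definition _ := linop_lmod.

Lemma linop_scaleAl (c : F) (f g : linop) : c *: (f * g) = c *: f * g.
Proof. exact: linopP. Qed.
HB.instance Definition _ :=
  GRing.Lmodule_isLalgebra.Build F linop linop_scaleAl.

Lemma linop_scaleAr (c : F) (f g : linop) : c *: (f * g) = f * (c *: g).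
Proof. by apply: linopP => v /=; rewrite linearZ. Qed.
HB.instance Definition _ :=
  GRing.Lalgebra_isAlgebra.Build F linop linop_scaleAr.

Lemma linopD (f g : linop) v : (f + g) v = f v + g v. Proof. by []. Qed.
Lemma linopM (f g : linop) v : (f * g) v = f (g v). Proof. by []. Qed.
Lemma linopZ c (f : linop) v : (c *: f) v = c *: f v. Proof. by []. Qed.
Lemma linop_sum I (r : seq I) (Q : pred I) (f : I -> linop) v :
  (\sum_(i <- r | Q i) f i) v = \sum_(i <- r | Q i) f i v.
Proof. by elim/big_rec2: _ => //= i y1 y2 _ <-. Qed.

End LinearOperators.

(** * Symbols *)

Section Symbols.
Variables (F : fieldType) (A : algType F) (y : A).

Definition ad (x : A) : A := y * x - x * y.

Fixpoint has_symbol (N : nat) (x : A) (c : F) : Prop :=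
  if N is N'.+1 then has_symbol N' (ad x) (N%:R * c) else x = c%:A.

Lemma adM x z : ad (x * z) = ad x * z + x * ad z.
Proof. by rewrite /ad mulrBl mulrBr !mulrA addrA subrK. Qed.

Lemma adD x z : ad (x + z) = ad x + ad z.
Proof. by rewrite /ad mulrDr mulrDl opprD addrACA. Qed.

Lemma adZ c x : ad (c *: x) = c *: ad x.
Proof. by rewrite /ad -scalerAr -scalerAl scalerBr. Qed.

Lemma ad_scalar c : ad c%:A = 0.
Proof. by rewrite /ad mulr_algr mulr_algl subrr. Qed.

Lemma ad0 : ad 0 = 0. Proof. by rewrite /ad mulr0 mul0r subrr. Qed.

Lemma has_symbol0 N : has_symbol N 0 0.
Proof. by elim: N => [|N IH] /=; rewrite ?scale0r // ad0 mulr0. Qed.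

Lemma has_symbolD N x z c d :
  has_symbol N x c -> has_symbol N z d -> has_symbol N (x + z) (c + d).
Proof.
elim: N x z c d => [|N IH] x z c d /=; first by move=> -> ->; rewrite scalerDl.
by rewrite adD mulrDr; apply: IH.
Qed.

Lemma has_symbolZ N x c d :
  has_symbol N x c -> has_symbol N (d *: x) (d * c).
Proof.
elim: N x c => [|N IH] x c /=; first by move=> ->; rewrite scalerA.
by rewrite adZ mulrCA; apply: IH.
Qed.

Lemma has_symbol_sum N I (r : seq I) (Q : pred I) (x : I -> A) (c : I -> F) :
  (forall i, Q i -> has_symbol N (x i) (c i)) ->
  has_symbol N (\sum_(i <- r | Q i) x i) (\sum_(i <- r | Q i) c i).
Proof.
move=> xc; elim/big_rec2: _ => [|i u v Qi]; first exact: has_symbol0.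
by apply: has_symbolD; apply: xc.
Qed.

Lemma has_symbolS N x c : has_symbol N x c -> has_symbol N.+1 x 0.
Proof.
elim: N x c => [|N IH] x c /=.
  by move=> ->; rewrite ad_scalar mulr0 scale0r.
by move=> /IH; rewrite /= !mulr0.
Qed.

Lemma has_symbol_lt N M x c : (N < M)%N -> has_symbol N x c -> has_symbol M x 0.
Proof.
elim: M => // M IH; rewrite ltnS leq_eqVlt => /orP[/eqP <-|NM] xc.
  exact: has_symbolS xc.
by apply: has_symbolS (IH NM xc).
Qed.

Lemma has_symbolM N M x z c d :
  has_symbol N x c -> has_symbol M z d -> has_symbol (N + M) (x * z) (c * d).
Proof.
move: {2}(N + M)%N (erefl (N + M)%N) => s; elim: s N M x z c d.
  by move=> [|//] [|//] x z c d _ /= -> ->; rewrite mulr_algl scalerA.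
move=> s IH N M x z c d NMs xc zd; rewrite NMs.
change (has_symbol s (ad (x * z)) (s.+1%:R * (c * d))).
rewrite adM -NMs natrD [X in has_symbol _ _ X]mulrDl.
apply: has_symbolD.
  case: N NMs xc => [|N] NMs /= xc.
    by rewrite xc ad_scalar mul0r mul0r; exact: has_symbol0.
  by rewrite mulrA; case: NMs => NMs; rewrite -NMs; apply: IH.
case: M NMs zd => [|M] NMs /= zd.
  by rewrite zd ad_scalar mulr0 mul0r; exact: has_symbol0.
rewrite mulrCA; move: NMs; rewrite addnS => -[NMs].
by rewrite -NMs; apply: IH.
Qed.

Lemma has_symbolX N k x c :
  has_symbol N x c -> has_symbol (N * k) (x ^+ k) (c ^+ k).
Proof.
move=> xc; elim: k => [|k IH]; first by rewrite muln0 /= scale1r.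
by rewrite mulnS !exprS; apply: has_symbolM.
Qed.

Lemma has_symbol_prod I (r : seq I) (N : I -> nat) (x : I -> A) (c : I -> F) :
  (forall i, has_symbol (N i) (x i) (c i)) ->
  has_symbol (\sum_(i <- r) N i) (\prod_(i <- r) x i) (\prod_(i <- r) c i).
Proof.
move=> xc; elim: r => [|i r IH]; first by rewrite !big_nil /= scale1r.
by rewrite !big_cons; apply: has_symbolM.
Qed.

Lemma has_symbol_inj N c : [pchar F] =i pred0 -> has_symbol N 0 c -> c = 0.
Proof.
move=> /pcharf0P F0; elim: N c => [|N IH] c /=.
  by move/esym/eqP; rewrite scaler_eq0 oner_eq0 orbF => /eqP.
by rewrite ad0 => /IH /eqP; rewrite mulf_eq0 F0 /= => /eqP.
Qed.

End Symbols.

Lemma digits_inj D n (a b : 'I_n -> nat) :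
  (forall i, a i < D)%N -> (forall i, b i < D)%N ->
  (\sum_(i < n) a i * D ^ i = \sum_(i < n) b i * D ^ i)%N -> a =1 b.
Proof.
elim: n a b => [|n IH] a b aD bD; first by move=> _ [].
have shift (c : 'I_n.+1 -> nat) : (\sum_(i < n.+1) c i * D ^ i =
    (\sum_(i < n) c (lift ord0 i) * D ^ i) * D + c ord0)%N.
  rewrite big_ord_recl /= muln1 addnC big_distrl /=; congr (_ + _)%N.
  by apply: eq_bigr => i _; rewrite /bump /= add1n expnSr mulnA.
have D0 : (0 < D)%N := leq_ltn_trans (leq0n _) (aD ord0).
rewrite !shift => E.
have E0 : a ord0 = b ord0.
  have := congr1 (fun k => k %% D)%N E.
  by rewrite !modnMDl !modn_small.
move/eqP: E; rewrite E0 eqn_add2r eqn_pmul2r // => /eqP /IH E1 i.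
case: (unliftP ord0 i) => [j ->|-> //].
exact: E1.
Qed.

(* Kronecker substitution X_i := t ^ (D ^ i) keeps distinct monomials apart. *)
Lemma mpoly_vanishing (F : fieldType) n (p : {mpoly F[n]}) :
  [pchar F] =i pred0 -> (forall v : 'I_n -> F, p.@[v] = 0) -> p = 0.
Proof.
move=> /pcharf0P F0 p0.
set D := msize p; pose e (m : 'X_{1..n}) := (\sum_(i < n) m i * D ^ i)%N.
pose u : {poly F} := \sum_(m <- msupp p) p@_m *: 'X^(e m).
have u0 : u = 0.
  apply: (@roots_geq_poly_eq0 _ u [seq k%:R | k <- iota 0 (size u)]).
  - apply/allP => _ /mapP[k _ ->]; apply/rootP.
    rewrite -[RHS](p0 (fun i => k%:R ^+ (D ^ i))) mevalE horner_sum.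
    apply: eq_bigr => m _; rewrite hornerZ hornerXn; congr (_ * _).
    rewrite -prodrXr; apply: eq_bigr => i _.
    by rewrite -exprM mulnC.
  - rewrite map_inj_uniq ?iota_uniq // => i j /eqP.
    wlog le_ij : i j / (i <= j)%N.
      move=> W; case: (leqP i j) => [|/ltnW] ij; first exact: W.
      by rewrite eq_sym => E; apply/esym/W.
    rewrite eq_sym -subr_eq0 -natrB // F0 subn_eq0 => ji.
    by apply/eqP; rewrite eqn_leq le_ij.
  - by rewrite size_map size_iota.
apply/mpolyP => m; rewrite mcoeff0.
have [mp|] := boolP (m \in msupp p); last by rewrite -mcoeff_eq0 => /eqP.
have := congr1 (fun q : {poly F} => q`_(e m)) u0; rewrite coef0 coef_sum.
rewrite (bigD1_seq m) ?msupp_uniq //= coefZ coefXn eqxx mulr1.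
rewrite big1_seq ?addr0 // => m' /andP[m'm m'p].
rewrite coefZ coefXn; case: eqP => [E|]; last by rewrite mulr0.
have lt m1 : m1 \in msupp p -> forall i, (m1 i < D)%N.
  move=> /msize_mdeg_lt m1D i; apply: leq_ltn_trans m1D.
  by rewrite mdegE (bigD1 i) //= leq_addr.
case/eqP: m'm; apply/mnmP => i.
by apply: (digits_inj (lt _ m'p) (lt _ mp)).
Qed.

(** * Ordered monomials *)

Section OrderedMonomials.
Variables (F : fieldType) (N : nat).

(* For noncommuting h, mmap evaluates each monomial as the product of the
   powers of the h i taken in increasing order of i. *)
Definition ordered_eval (A : algType F) (h : 'I_N -> A) (p : {mpoly F[N]}) : A :=
  mmap (in_alg A) h p.

Lemma ordered_evalD (A : algType F) (h : 'I_N -> A) p q :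
  ordered_eval h (p + q) = ordered_eval h p + ordered_eval h q.
Proof. exact: mmapD. Qed.

Lemma ordered_evalZ (A : algType F) (h : 'I_N -> A) c p :
  ordered_eval h (c *: p) = c *: ordered_eval h p.
Proof. by rewrite /ordered_eval mmapZ mulr_algl. Qed.

Lemma ordered_eval0 (A : algType F) (h : 'I_N -> A) : ordered_eval h 0 = 0.
Proof. exact: mmap0. Qed.

Lemma ordered_eval1 (A : algType F) (h : 'I_N -> A) : ordered_eval h 1 = 1.
Proof. by rewrite -mpolyX0 /ordered_eval mmapX mmap11. Qed.

Lemma ordered_eval_sum (A : algType F) (h : 'I_N -> A)
    I (r : seq I) (p : I -> {mpoly F[N]}) :
  ordered_eval h (\sum_(i <- r) p i) = \sum_(i <- r) ordered_eval h (p i).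
Proof. exact: raddf_sum. Qed.

Lemma ordered_evalX (A : algType F) (h : 'I_N -> A) m :
  ordered_eval h 'X_[m] = mmap1 h m.
Proof. exact: mmapX. Qed.

Lemma mmap1_mul_least (A : nzRingType) (h : 'I_N -> A) (m : 'X_{1..N}) (i : 'I_N) :
  (forall j : 'I_N, (j < i)%N -> m j = 0%N) ->
  h i * mmap1 h m = mmap1 h (U_(i) + m).
Proof.
move=> m0; rewrite /mmap1.
have -> : index_enum 'I_N = enum 'I_N by rewrite enumT [LHS]unlock.
have: pairwise (fun j k : 'I_N => j < k)%N (enum 'I_N).
  rewrite -(pairwise_map val (fun j k => j < k)%N) val_enum_ord.
  by rewrite -sorted_pairwise ?iota_ltn_sorted //; exact: ltn_trans.
have := mem_enum 'I_N i; rewrite inE.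
elim: (enum 'I_N) => // a r IH; rewrite in_cons !big_cons /= => ir /andP[ar rr].
rewrite mnmDE mnm1E; case: (eqVneq i a) ir => [ia|ia] /= ir.
  rewrite ia mulrA -exprS add1n; congr (_ * _); rewrite big_seq [RHS]big_seq.
  apply: eq_bigr => j jr; rewrite mnmDE mnm1E.
  case: eqP => // ij; move/allP: ar => /(_ j jr).
  by rewrite -ij ltnn.
have ai : (a < i)%N by move/allP: ar; apply.
by rewrite m0 // !mul1r; apply: IH.
Qed.

Variable c : 'I_N -> 'I_N -> 'I_N -> F.

Definition structure_rel (A : algType F) (h : 'I_N -> A) :=
  forall i j, h i * h j = h j * h i + \sum_k c i j k *: h k.

Definition lmul_lower (d : nat) (i : 'I_N) (p : {mpoly F[N]}) :=
  exists2 r : {mpoly F[N]}, (msize r <= d)%N &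
  forall (A : algType F) (h : 'I_N -> A), structure_rel h ->
    h i * ordered_eval h p = ordered_eval h ('X_i * p + r).

Lemma msizeXM (d : nat) (i : 'I_N) (p : {mpoly F[N]}) :
  (msize p <= d)%N -> (msize ('X_i * p) <= d.+1)%N.
Proof.
have [->|p0] := eqVneq p 0; first by rewrite mulr0 msize0.
have X0 : 'X_i != 0 :> {mpoly F[N]} by rewrite -msize_poly_eq0 msizeX.
have E := msizeX F U_(i)%MM; rewrite mdeg1 in E.
by rewrite msizeM // [X in (X + _)%N]E.
Qed.

Lemma msizeD_leq (d : nat) (p q : {mpoly F[N]}) :
  (msize p <= d)%N -> (msize q <= d)%N -> (msize (p + q) <= d)%N.
Proof. by move=> pd qd; rewrite (leq_trans (msizeD_le _ _)) // geq_max pd. Qed.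

Lemma msize_lincomb (d : nat) I (r : seq I) (a : I -> F) (p : I -> {mpoly F[N]}) :
  (forall i, msize (p i) <= d)%N -> (msize (\sum_(i <- r) a i *: p i) <= d)%N.
Proof.
move=> pd; elim/big_rec: _ => [|i q _ qd]; first by rewrite msize0.
by apply: msizeD_leq => //; rewrite (leq_trans (msizeZ_le _ _)).
Qed.

Lemma lmul_lower_span d i p :
  {in msupp p, forall m, lmul_lower d i 'X_[m]} -> lmul_lower d i p.
Proof.
rewrite {2}[p]mpolyE; elim: (msupp p) => [|m s IH] ms.
  rewrite big_nil; exists 0; first by rewrite msize0.
  by move=> A h _; rewrite mulr0 addr0 ordered_eval0 mulr0.
rewrite big_cons; have [r rd rE] := ms m (mem_head _ _).
have [|r' r'd r'E] := IH.
  by move=> m' m's; apply: ms; rewrite in_cons m's orbT.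
exists (p@_m *: r + r').
  by apply: msizeD_leq => //; rewrite (leq_trans (msizeZ_le _ _)).
move=> A h hc; rewrite ordered_evalD mulrDr r'E // ordered_evalZ -scalerAr rE //.
rewrite -ordered_evalZ -ordered_evalD scalerDr mulrDr -scalerAr.
by rewrite addrACA.
Qed.

Lemma lmul_lowerP d i p : (msize p <= d)%N -> lmul_lower d i p.
Proof.
elim: d i p => [|d IH] i p.
  rewrite leqn0 msize_poly_eq0 => /eqP ->; exists 0; first by rewrite msize0.
  by move=> A h _; rewrite mulr0 addr0 ordered_eval0 mulr0.
move=> pd; apply: lmul_lower_span => m /msize_mdeg_lt /leq_trans /(_ pd).
rewrite ltnS {p pd} => md.
have [/existsP[j0 j0P]|/existsPn/= mi] :=
    boolP [exists j : 'I_N, (j < i)%N && (m j != 0%N)]; last first.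
  exists 0; first by rewrite msize0.
  move=> A h _; rewrite addr0 -mpolyXD !ordered_evalX mmap1_mul_least // => j ji.
  by move: (mi j); rewrite ji negbK => /eqP.
case: (@arg_minnP _ j0 (fun j => (j < i)%N && (m j != 0%N)) val j0P).
move=> j /andP[ji mj] jmin.
have mlt (k : 'I_N) : (k < j)%N -> m k = 0%N.
  move=> kj; apply/eqP/negPn/negP => mk.
  have /jmin : (k < i)%N && (m k != 0%N) by rewrite (ltn_trans kj ji).
  by rewrite /= leqNgt kj.
pose m' := (m - U_(j))%MM.
have mE : m = (U_(j) + m')%MM by rewrite addmC submK // lep1mP.
have m'lt (k : 'I_N) : (k < j)%N -> m' k = 0%N.
  by move=> kj; rewrite mnmBE mlt.
have m'd : (msize ('X_[m'] : {mpoly F[N]}) <= d)%N.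
  by rewrite msizeX; move: md; rewrite mE mdegD mdeg1.
have [r1 r1d r1E] := IH i _ m'd.
have [r2 r2d r2E] := IH j _ r1d.
have [r3 r3d r3E] := fin_all_exists2 (fun k => IH k _ m'd).
exists ('X_j * r1 + r2 + \sum_k c i j k *: ('X_k * 'X_[m'] + r3 k)).
  apply: msizeD_leq; first by apply: msizeD_leq; [exact: msizeXM | exact: leqW].
  apply: msize_lincomb => k.
  by apply: msizeD_leq; [exact: msizeXM | exact: leqW].
move=> A h hc; rewrite ordered_evalX {1}mE -mmap1_mul_least // mulrA hc mulrDl.
rewrite -mulrA -ordered_evalX r1E // ordered_evalD mulrDr r2E //.
rewrite -mpolyXD ordered_evalX mmap1_mul_least; last first.
  move=> k kj; rewrite mnmDE mnm1E m'lt // addn0.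
  by apply/eqP; rewrite eqb0 neq_ltn (ltn_trans kj ji) orbT.
rewrite -addrA [RHS]ordered_evalD; congr (_ + _).
  by rewrite mE -mpolyXD ordered_evalX !addmA [(U_(j) + U_(i))%MM]addmC.
rewrite [RHS]ordered_evalD; congr (_ + _).
rewrite ordered_eval_sum mulr_suml; apply: eq_bigr => k _.
by rewrite ordered_evalZ -scalerAl r3E.
Qed.

End OrderedMonomials.

(** * A criterion for injectivity on the enveloping algebra *)

Lemma oeval_linop (F : fieldType) (T : finType) (X : Type)
    (phi : X -> op F T) (psi : X -> linop (pol F T)) (t : term F X) :
  (forall x, phi x =1 psi x) -> oeval phi t =1 aeval psi t.
Proof.
move=> phiE; elim: t => //= [s IHs u IHu|s IHs u IHu|c s IHs] p.
- by rewrite IHs IHu.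
- by rewrite IHs IHu.
- by rewrite IHs.
Qed.

Section SymbolCriterion.
Variables (F : fieldType) (m : nat) (P : 'M[F]_m -> Prop).
Variable U : {vspace 'M[F]_m}.
Hypothesis PU : forall X, P X <-> X \in U.
Hypothesis U_lie : forall X Y, X \in U -> Y \in U -> X *m Y - Y *m X \in U.

Local Notation N := (\dim U).
Local Notation x := (vbasis U).

Lemma basis_in i : x`_i \in U.
Proof.
have [iN|iN] := ltnP i N; last by rewrite nth_default ?size_tuple ?mem0v.
by rewrite vbasis_mem // mem_nth // size_tuple.
Qed.

Lemma lie_hom_coord (A : algType F) (f : 'M[F]_m -> A) X :
  is_lie_hom P f -> X \in U -> f X = \sum_(i < N) coord x i X *: f x`_i.
Proof.
move=> [flin _] XU; rewrite {1}(coord_vbasis XU).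
have P0 : P 0 by apply/PU; exact: mem0v.
have f0 : f 0 = 0.
  by have := flin (-1) 0 0 P0 P0; rewrite scaler0 addr0 scaleN1r addNr.
suff [] : P (\sum_(i < N) coord x i X *: x`_i) /\
  f (\sum_(i < N) coord x i X *: x`_i) = \sum_(i < N) coord x i X *: f x`_i by [].
elim/big_rec2: _ => // i u v _ [Pv fv]; have Px := (PU _).2 (basis_in i).
split; last by rewrite flin // fv.
by apply/PU; rewrite memvD ?memvZ //; apply/PU.
Qed.

Definition lie_coef (i j k : 'I_N) : F :=
  coord x k (x`_i *m x`_j - x`_j *m x`_i).

Lemma lie_hom_structure (A : algType F) (f : 'M[F]_m -> A) :
  is_lie_hom P f -> structure_rel lie_coef (fun i : 'I_N => f x`_i).
Proof.
move=> fhom i j; rewrite -lie_hom_coord // ?U_lie ?basis_in //.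
have [_ ->] := fhom; first by rewrite addrC subrK.
  by apply/PU/basis_in.
by apply/PU/basis_in.
Qed.

Definition basis_eval (A : algType F) (f : 'M[F]_m -> A) :=
  ordered_eval (fun i : 'I_N => f x`_i).

Lemma aeval_basis_mul (t : term F 'M[F]_m) (q : {mpoly F[N]}) : term_over P t ->
  exists r, forall (A : algType F) (f : 'M[F]_m -> A), is_lie_hom P f ->
    aeval f t * basis_eval f q = basis_eval f r.
Proof.
elim: t q => [X||s IHs u IHu|s IHs u IHu|c s IHs] q /=.
- move=> /PU XU.
  have [r _ rE] := fin_all_exists2
    (fun k => lmul_lowerP lie_coef k (leqnn (msize q))).
  exists (\sum_k coord x k X *: ('X_k * q + r k)) => A f fhom.
  rewrite (lie_hom_coord fhom XU) mulr_suml /basis_eval ordered_eval_sum.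
  apply: eq_bigr => k _; rewrite -scalerAl ordered_evalZ.
  by rewrite -rE //; exact: lie_hom_structure.
- by exists q => A f _; rewrite mul1r.
- move=> [/(IHs q)[r1 r1E] /(IHu q)[r2 r2E]]; exists (r1 + r2) => A f fhom.
  by rewrite mulrDl r1E // r2E // /basis_eval ordered_evalD.
- move=> [Ps /(IHu q)[r1 r1E]]; have [r2 r2E] := IHs r1 Ps.
  by exists r2 => A f fhom; rewrite -mulrA r1E // r2E.
- move=> /(IHs q)[r rE]; exists (c *: r) => A f fhom.
  by rewrite -scalerAl rE // /basis_eval ordered_evalZ.
Qed.

Hypothesis F0 : [pchar F] =i pred0.
Variables (B : algType F) (psi : 'M[F]_m -> B).

(* The second-order symbols of the psi X at the point of phase space singled
   out by y form a linear functional on the Lie algebra; all functionals occur. *)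
Hypothesis psi_symbol : forall G : 'M[F]_m, exists y : B,
  forall X, P X -> has_symbol y 2 (psi X) (\sum_r \sum_s X r s * G r s).

Lemma mmap1_symbol (y : B) (h : 'I_N -> B) (a : 'I_N -> F) (e : 'X_{1..N}) :
  (forall i, has_symbol y 2 (h i) (a i)) ->
  has_symbol y (2 * mdeg e) (mmap1 h e) (\prod_i a i ^+ e i).
Proof.
move=> ha; rewrite mdegE big_distrr /=; apply: has_symbol_prod => i.
exact: has_symbolX.
Qed.

Lemma functional_matrix (g : {scalar 'M[F]_m}) X :
  g X = \sum_r \sum_s X r s * g (delta_mx r s).
Proof.
rewrite {1}(matrix_sum_delta X) linear_sum; apply: eq_bigr => r _.
by rewrite linear_sum; apply: eq_bigr => s _; rewrite linearZ.
Qed.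

Lemma basis_eval_inj p : basis_eval psi p = 0 -> p = 0.
Proof.
move=> p0; apply/eqP/negPn/negP => pn0.
pose d := mdeg (mlead p).
have dE e : e \in msupp p -> (mdeg e <= d)%N.
  by move/msize_mdeg_lt; rewrite -mlead_deg.
pose top := \sum_(e <- msupp p) (if mdeg e == d then p@_e else 0) *: 'X_[e].
have /(congr1 (mcoeff (mlead p))) : top = 0.
  apply: mpoly_vanishing => // a.
  have [y yP] : exists y : B, forall i : 'I_N, has_symbol y 2 (psi x`_i) (a i).
    pose g (X : 'M[F]_m) : F := \sum_(i < N) a i * coord x i X.
    have glin : scalar g.
      move=> c X Y; rewrite /g mulr_sumr -big_split; apply: eq_bigr => i _ /=.
      by rewrite linearP /= mulrDr mulrCA.
    pose gl : {scalar 'M[F]_m} :=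
      HB.pack g (GRing.isLinear.Build F 'M[F]_m F *%R g glin).
    have [y yP] := psi_symbol (\matrix_(r, s) g (delta_mx r s)).
    exists y => i; have := yP x`_i ((PU _).2 (basis_in i)).
    have -> : \sum_r \sum_s x`_i r s * (\matrix_(r, s) g (delta_mx r s)) r s = g x`_i.
      rewrite -[g _]/(gl _) functional_matrix.
      by apply: eq_bigr => r _; apply: eq_bigr => s _; rewrite mxE.
    suff -> : g x`_i = a i by [].
    rewrite /g (bigD1 i) //= coord_free ?(basis_free (vbasisP U)) // eqxx mulr1.
    rewrite big1 ?addr0 // => j ji.
    by rewrite coord_free ?(basis_free (vbasisP U)) // eq_sym (negPf ji) mulr0.
  apply: (@has_symbol_inj _ _ y (2 * d)) => //.
  rewrite -p0 /basis_eval /ordered_eval /mmap /top raddf_sum /=.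
  rewrite big_seq [X in has_symbol _ _ _ X]big_seq.
  apply: has_symbol_sum => e ep; rewrite mevalZ mevalX mulr_algl.
  case: eqP => [<-|/eqP ed]; first by apply: has_symbolZ; apply: mmap1_symbol.
  rewrite mul0r -(mulr0 p@_e); apply: has_symbolZ.
  apply: has_symbol_lt (mmap1_symbol e yP).
  by rewrite ltn_pmul2l // ltn_neqAle ed dE.
rewrite mcoeff0 /top raddf_sum /= (bigD1_seq (mlead p)) ?mlead_supp ?msupp_uniq //=.
rewrite mcoeffZ mcoeffX !eqxx mulr1 big1 ?addr0 => [/eqP|e en].
  by rewrite mleadc_eq0 (negPf pn0).
by rewrite mcoeffZ mcoeffX (negPf en) mulr0.
Qed.

Hypothesis psi_hom : is_lie_hom P psi.

Lemma aeval_symbol_inj (s t : term F 'M[F]_m) : term_over P s -> term_over P t ->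
  aeval psi s = aeval psi t ->
  forall (A : algType F) (f : 'M[F]_m -> A), is_lie_hom P f ->
    aeval f s = aeval f t.
Proof.
move=> Ps Pt st A f fhom; pose u := tadd s (tscale (-1) t).
have [|r rE] := @aeval_basis_mul u 1; first by [].
have uE (C : algType F) (g : 'M[F]_m -> C) :
    is_lie_hom P g -> aeval g s - aeval g t = basis_eval g r.
  move=> ghom; rewrite -rE // /basis_eval ordered_eval1 mulr1 /=.
  by rewrite scaleN1r.
have r0 : r = 0 by apply: basis_eval_inj; rewrite -uE // st subrr.
by apply/eqP; rewrite -subr_eq0 uE // r0 /basis_eval ordered_eval0.
Qed.

End SymbolCriterion.

Lemma U_injective_symbol (F : fieldType) (T : finType) (m : nat)
    (P : 'M[F]_m -> Prop) (U : {vspace 'M[F]_m})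
    (phi : 'M[F]_m -> op F T) (psi : 'M[F]_m -> linop (pol F T)) :
  [pchar F] =i pred0 -> (forall X, P X <-> X \in U) ->
  (forall X Y, X \in U -> Y \in U -> X *m Y - Y *m X \in U) ->
  (forall X, phi X =1 psi X) -> is_lie_hom P psi ->
  (forall G : 'M[F]_m, exists y, forall X, P X ->
     has_symbol y 2 (psi X) (\sum_r \sum_s X r s * G r s)) ->
  U_injective P phi.
Proof.
move=> F0 PU U_lie phiE psi_hom psi_symbol s t Ps Pt st.
apply: (aeval_symbol_inj PU U_lie F0 psi_symbol psi_hom Ps Pt).
by apply: linopP => p; rewrite -!(oeval_linop _ phiE) st.
Qed.

(** * Gram matrices *)

Section GramMatrices.
Variables (F : closedFieldType) (m : nat).
Hypothesis two0 : (2%:R : F) != 0.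

Definition form (S : 'M[F]_m) (u v : 'rV[F]_m) : F := (u *m S *m v^T) 0 0.

Lemma form_mx S u v : u *m S *m v^T = (form S u v)%:M.
Proof. exact: mx11_scalar. Qed.

Lemma form_tr S u v : form S^T u v = form S v u.
Proof.
have -> : form S v u = (v *m S *m u^T)^T 0 0 by rewrite mxE.
by rewrite !trmx_mul trmxK mulmxA.
Qed.

Lemma form_delta S i j : form S (delta_mx 0 i) (delta_mx 0 j) = S i j.
Proof. by rewrite /form -rowE trmx_delta -colE !mxE. Qed.

Lemma formDl S u1 u2 v : form S (u1 + u2) v = form S u1 v + form S u2 v.
Proof. by rewrite /form !mulmxDl mxE. Qed.

Lemma formDr S u v1 v2 : form S u (v1 + v2) = form S u v1 + form S u v2.
Proof. by rewrite /form linearD mulmxDr mxE. Qed.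

Lemma nonzero_entry (S : 'M[F]_m) : S != 0 -> exists i j, S i j != 0.
Proof.
move=> S0; suff /existsP[i /existsP[j Sij]] : [exists i, exists j, S i j != 0].
  by exists i, j.
apply: contra_neqT S0 => /existsPn S0.
by apply/matrixP => i j; move: (S0 i) => /existsPn/(_ j)/negPn/eqP ->; rewrite mxE.
Qed.

Lemma sym_anisotropic (S : 'M[F]_m) : S^T = S -> S != 0 ->
  exists u, form S u u != 0.
Proof.
move=> Ssym /nonzero_entry[i [j Sij]].
have [Sii|] := eqVneq (S i i) 0; last by exists (delta_mx 0 i); rewrite form_delta.
have [Sjj|] := eqVneq (S j j) 0; last by exists (delta_mx 0 j); rewrite form_delta.
exists (delta_mx 0 i + delta_mx 0 j).
rewrite formDl !formDr !form_delta Sii Sjj add0r addr0.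
have -> : S j i = S i j by rewrite -{1}Ssym mxE.
by rewrite -mulr2n -mulr_natr mulf_neq0.
Qed.

Lemma sqrt_exists (a : F) : exists s, s * s = a.
Proof.
have [s] := @solve_monicpoly F 2 (fun i => if i is 0%N then a else 0) isT.
by rewrite !big_ord_recl big_ord0 /= mulr1 mul0r !addr0 expr2 => sE; exists s.
Qed.

Lemma rank_ltn_ker (S S' : 'M[F]_m) (W : 'M[F]_m) :
  (kermx S < W)%MS -> (W <= kermx S')%MS -> (\rank S' < \rank S)%N.
Proof.
move=> /ltmx_sub_trans h /h /rank_ltmx; rewrite !mxrank_ker => lt.
have Sm : (\rank S <= m)%N := rank_leq_row S.
have S'm : (\rank S' <= m)%N := rank_leq_row S'.
by rewrite ltnNge; apply/negP => le; move: lt; rewrite ltnNge leq_sub2l.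
Qed.

Lemma sym_gram k (S : 'M[F]_m) : S^T = S -> (\rank S <= k)%N ->
  exists V : 'M[F]_(k, m), V^T *m V = S.
Proof.
elim: k S => [|k IH] S Ssym Sk.
  move: Sk; rewrite leqn0 mxrank_eq0 => /eqP ->.
  by exists 0; rewrite mulmx0.
have [->|S0] := eqVneq S 0; first by exists 0; rewrite mulmx0.
have [u u0] := sym_anisotropic Ssym S0.
pose a := form S u u; pose w := u *m S.
have wT : w^T = S *m u^T by rewrite trmx_mul Ssym.
pose S' := S - a^-1 *: (w^T *m w).
have uS' : u *m S' = 0.
  rewrite mulmxBr -scalemxAr wT !mulmxA form_mx mul_scalar_mx -scalemxAl scalerA.
  by rewrite mulVf // scale1r subrr.
have kS' : kermx S *m S' = 0.
  by rewrite mulmxBr -scalemxAr wT !mulmxA mulmx_ker !mul0mx scaler0 subrr.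
have [|| V VE] := IH S'.
- by rewrite linearB linearZ /= trmx_mul trmxK Ssym.
- rewrite -ltnS; apply: leq_trans Sk; apply: (@rank_ltn_ker _ _ (kermx S + u)%MS).
    rewrite ltmxE addsmxSl /= addsmx_sub submx_refl /=.
    apply/negP => /sub_kermxP uS; move: u0.
    by rewrite /form uS mul0mx mxE eqxx.
  by rewrite addsmx_sub; apply/andP; split; apply/sub_kermxP.
have [s sE] := sqrt_exists a^-1.
change (exists V : 'M[F]_(1 + k, m), V^T *m V = S); exists (col_mx (s *: w) V).
rewrite tr_col_mx mul_row_col VE [(s *: w)^T]linearZ /=.
rewrite -scalemxAl -scalemxAr scalerA sE.
by rewrite /S' addrC subrK.
Qed.

Lemma alt_gram k (S : 'M[F]_m) : S^T = - S -> (\rank S <= k + k)%N ->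
  exists V : 'M[F]_(k + k, m), V^T *m omega F k *m V = S.
Proof.
move=> Salt Sk.
suff [P [Q PQ]] : exists P Q : 'M[F]_(k, m), P^T *m Q - Q^T *m P = S.
  exists (col_mx P Q); rewrite tr_col_mx /omega mul_row_block !mulmx0 mulmxN !mulmx1.
  by rewrite add0r addr0 mul_row_col mulNmx addrC.
elim: k S Salt Sk => [|k IH] S Salt Sk.
  move: Sk; rewrite leqn0 mxrank_eq0 => /eqP ->.
  by exists 0, 0; rewrite mulmx0 subrr.
have [->|S0] := eqVneq S 0; first by exists 0, 0; rewrite mulmx0 subrr.
have [i [j Sij]] := nonzero_entry S0.
pose u : 'rV[F]_m := delta_mx 0 i; pose v : 'rV[F]_m := delta_mx 0 j.
have swap x y : form S x y = - form S y x.
  by rewrite -form_tr Salt /form mulmxN mulNmx mxE.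
have isot x : form S x x = 0.
  have /eqP := swap x x; rewrite -addr_eq0 -mulr2n -mulr_natr mulf_eq0.
  by rewrite (negPf two0) orbF => /eqP.
pose a := form S u v; have a0 : a != 0 by rewrite /a form_delta.
pose p := u *m S; pose q := v *m S.
have pT : p^T = - (S *m u^T) by rewrite trmx_mul Salt mulNmx.
have qT : q^T = - (S *m v^T) by rewrite trmx_mul Salt mulNmx.
pose S' := S - a^-1 *: (p^T *m q - q^T *m p).
have uS' : u *m S' = 0.
  rewrite mulmxBr -scalemxAr mulmxBr pT qT !mulNmx !mulmxN !mulmxA !form_mx.
  rewrite isot -/a !mul_scalar_mx scale0r mul0mx oppr0 add0r opprK.
  rewrite -scalemxAl scalerA mulVf //.
  by rewrite scale1r subrr.
have vS' : v *m S' = 0.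
  rewrite mulmxBr -scalemxAr mulmxBr pT qT !mulNmx !mulmxN !mulmxA !form_mx.
  rewrite isot (swap v u) -/a !mul_scalar_mx scale0r mul0mx oppr0 oppr0 addr0.
  by rewrite scaleNr mulNmx opprK -scalemxAl scalerA mulVf // scale1r subrr.
have kS' : kermx S *m S' = 0.
  rewrite mulmxBr -scalemxAr mulmxBr pT qT !mulNmx !mulmxN !mulmxA mulmx_ker.
  by rewrite !mul0mx !oppr0 addr0 scaler0 subrr.
have [|| P [Q PQ]] := IH S'.
- rewrite linearB linearZ linearB /= !trmx_mul !trmxK Salt.
  by rewrite -[- (_ *: _)]scalerN opprB /S' opprB addrC pT qT !mulNmx.
- have lt1 : (kermx S < kermx S + u)%MS.
    rewrite ltmxE addsmxSl /= addsmx_sub submx_refl /=.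
    apply/negP => /sub_kermxP uS; move: a0.
    by rewrite /a /form uS mul0mx mxE eqxx.
  have lt2 : (kermx S + u < (kermx S + u) + v)%MS.
    rewrite ltmxE addsmxSl /= addsmx_sub submx_refl /=.
    apply/negP => /sub_addsmxP[[b c] /= vE]; move: a0.
    have vS : v *m S = c *m (u *m S).
      by rewrite {1}vE mulmxDl -[b *m _ *m S]mulmxA mulmx_ker mulmx0 add0r mulmxA.
    rewrite /a swap /form vS -mulmxA form_mx isot.
    by rewrite mul_mx_scalar scale0r mxE oppr0 eqxx.
  have /mxrankS le3 : ((kermx S + u) + v <= kermx S')%MS.
    by rewrite !addsmx_sub -andbA; apply/and3P; split; apply/sub_kermxP.
  move: (leq_trans (rank_ltmx lt2) le3) (rank_ltmx lt1).
  rewrite !mxrank_ker; have := rank_leq_row S; have := rank_leq_row S'.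
  move: (\rank _) (\rank S) (\rank S') Sk => r2 r1 r0; rewrite addnS addSn.
  lia.
change (exists P Q : 'M[F]_(1 + k, m), P^T *m Q - Q^T *m P = S).
exists (col_mx (a^-1 *: p) P), (col_mx q Q).
rewrite !tr_col_mx !mul_row_col [(a^-1 *: p)^T]linearZ /= -scalemxAl -scalemxAr.
by rewrite opprD addrACA PQ -scalerBr /S' addrC subrK.
Qed.

End GramMatrices.

(** * Commutators with quadratic elements *)

Section Commutators.
Variables (F : fieldType) (A : algType F).

Lemma ad_sum (y : A) I (r : seq I) (Q : pred I) (x : I -> A) :
  ad y (\sum_(i <- r | Q i) x i) = \sum_(i <- r | Q i) ad y (x i).
Proof. by apply: (big_morph (ad y)) => [u v|]; [exact: adD | exact: ad0]. Qed.

Lemma adC (y x : A) : ad y x = - ad x y.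
Proof. by rewrite /ad opprB. Qed.

Lemma ad_symbol1 (y x : A) (c : F) : ad y x = c%:A -> has_symbol y 1 x c.
Proof. by rewrite /= mul1r. Qed.

Section Quadratic.
Variables (I : finType) (w : I -> A).

Definition quad (M : I -> I -> F) : A :=
  2^-1 *: \sum_i \sum_j M i j *: (w i * w j).

Lemma eq_quad M M' : M =2 M' -> quad M = quad M'.
Proof.
move=> MM'; congr (_ *: _); apply: eq_bigr => i _; apply: eq_bigr => j _.
by rewrite MM'.
Qed.

Lemma quadP c M M' : quad (fun i j => c * M i j + M' i j) = c *: quad M + quad M'.
Proof.
rewrite /quad scalerA mulrC -scalerA -scalerDr; congr (_ *: _).
rewrite scaler_sumr -big_split; apply: eq_bigr => i _ /=.
rewrite scaler_sumr -big_split; apply: eq_bigr => j _ /=.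
by rewrite scalerDl scalerA.
Qed.

Lemma quad_symbol (y : A) (M : I -> I -> F) (v : I -> F) :
  (forall i, has_symbol y 1 (w i) (v i)) ->
  has_symbol y 2 (quad M) (2^-1 * \sum_i \sum_j M i j * (v i * v j)).
Proof.
move=> wv; apply: has_symbolZ; apply: has_symbol_sum => i _.
apply: has_symbol_sum => j _; apply: has_symbolZ.
exact: (has_symbolM (wv i) (wv j)).
Qed.

Variable Om : I -> I -> F.
Hypothesis wOm : forall i j, ad (w i) (w j) = (Om i j)%:A.
Hypothesis two0 : (2%:R : F) != 0.

Lemma quad_ad (M : I -> I -> F) k : (forall i j, M j i = M i j) ->
  ad (quad M) (w k) = - \sum_i (\sum_j M i j * Om k j) *: w i.
Proof.
move=> Msym; rewrite adC adZ ad_sum; congr (- _).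
have -> : \sum_i ad (w k) (\sum_j M i j *: (w i * w j)) =
    \sum_i (\sum_j M i j * Om k j) *: w i + \sum_i (\sum_j M i j * Om k j) *: w i.
  transitivity (\sum_i \sum_j (M i j * Om k i) *: w j
              + \sum_i \sum_j (M i j * Om k j) *: w i).
    rewrite -big_split; apply: eq_bigr => i _; rewrite ad_sum -big_split.
    apply: eq_bigr => j _ /=; rewrite adZ adM !wOm mulr_algl mulr_algr.
    by rewrite scalerDr !scalerA.
  congr (_ + _); last by apply: eq_bigr => i _; rewrite scaler_suml.
  rewrite exchange_big; apply: eq_bigr => j _ /=; rewrite scaler_suml.
  by apply: eq_bigr => i _; rewrite Msym.
by rewrite -mulr2n -scaler_nat scalerA mulVf // scale1r.
Qed.

Lemma quad_deriv (y : A) (T M : I -> I -> F) :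
  (forall k, ad y (w k) = \sum_l T l k *: w l) ->
  ad y (quad M) =
  quad (fun i j => \sum_l T i l * M l j + \sum_l T j l * M i l).
Proof.
move=> yT; rewrite adZ ad_sum; congr (_ *: _).
transitivity (\sum_i \sum_j \sum_l (T l i * M i j) *: (w l * w j)
            + \sum_i \sum_j \sum_l (T l j * M i j) *: (w i * w l)).
  rewrite -big_split; apply: eq_bigr => i _; rewrite ad_sum -big_split.
  apply: eq_bigr => j _ /=; rewrite adZ adM !yT mulr_suml mulr_sumr scalerDr.
  rewrite !scaler_sumr; congr (_ + _); apply: eq_bigr => l _.
    by rewrite -scalerAl scalerA mulrC.
  by rewrite -scalerAr scalerA mulrC.
transitivity (\sum_i \sum_j \sum_l (T i l * M l j) *: (w i * w j)
            + \sum_i \sum_j \sum_l (T j l * M i l) *: (w i * w j)); last first.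
  rewrite -big_split; apply: eq_bigr => i _; rewrite -big_split.
  by apply: eq_bigr => j _ /=; rewrite scalerDl !scaler_suml.
congr (_ + _).
  rewrite exchange_big [RHS]exchange_big; apply: eq_bigr => j _ /=.
  exact: exchange_big.
by apply: eq_bigr => i _; exact: exchange_big.
Qed.

Lemma ad_lincomb (c : I -> F) k :
  ad (\sum_i c i *: w i) (w k) = (\sum_i c i * Om i k)%:A.
Proof.
rewrite adC ad_sum -sumrN scaler_suml; apply: eq_bigr => i _.
by rewrite adZ -scalerN -adC wOm scalerA.
Qed.

End Quadratic.
End Commutators.

Section FormAlgebra.
Variables (F : fieldType) (n : nat) (C : 'M[F]_n).

Definition form_defect (X : 'M[F]_n) : 'M[F]_n := X^T *m C + C *m X.

Lemma form_defect_linear : linear form_defect.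
Proof.
move=> c X Y; rewrite /form_defect linearP /= mulmxDl mulmxDr scalerDr.
by rewrite -scalemxAl -scalemxAr addrACA.
Qed.
HB.instance Definition _ :=
  GRing.isLinear.Build F 'M[F]_n 'M[F]_n *:%R form_defect form_defect_linear.

Definition form_algebra : {vspace 'M[F]_n} := lker (linfun form_defect).

Lemma form_algebraP X : form_defect X = 0 <-> X \in form_algebra.
Proof. by rewrite memv_ker lfunE; split => /eqP. Qed.

Lemma form_algebra_lie X Y : X \in form_algebra -> Y \in form_algebra ->
  X *m Y - Y *m X \in form_algebra.
Proof.
move=> /form_algebraP/eqP; rewrite addr_eq0 => /eqP XE.
move=> /form_algebraP/eqP; rewrite addr_eq0 => /eqP YE.
apply/form_algebraP; rewrite /form_defect linearB /= !trmx_mul mulmxBl mulmxBr.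
rewrite -!mulmxA XE YE !mulmxN !mulmxA XE YE !mulNmx !opprK.
by rewrite addrC addrA subrK subrr.
Qed.

End FormAlgebra.

Lemma tr_scale_entry (F : fieldType) m (M : 'M[F]_m) (c : F) i j :
  M^T = c *: M -> M j i = c * M i j.
Proof. by move=> /(congr1 (fun Z : 'M[F]_m => Z i j)); rewrite !mxE. Qed.

Lemma sum_pair_delta (F : fieldType) (I J : finType) (f : I -> J -> F) a :
  \sum_(l : I * J) (a == l.1)%:R * f l.1 l.2 = \sum_s f a s.
Proof.
rewrite -(pair_bigA _ (fun b s => (a == b)%:R * f b s)) /= (bigD1 a) //= eqxx.
rewrite [X in _ + X]big1 ?addr0 => [|b ba].
  by apply: eq_bigr => s _; rewrite mul1r.
by apply: big1 => s _; rewrite eq_sym (negPf ba) mul0r.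
Qed.

Lemma pairing_tr (F : fieldType) m n (M N : 'M[F]_(m, n)) :
  \sum_r \sum_s M r s * N r s = \tr (M^T *m N).
Proof.
rewrite exchange_big; apply: eq_bigr => s _; rewrite mxE.
by apply: eq_bigr => r _; rewrite mxE.
Qed.

Lemma sum_congruence (F : fieldType) k n (K : 'M[F]_k) (Y : 'M[F]_n)
    (V : 'M[F]_(k, n)) :
  \sum_(i : 'I_k * 'I_n) \sum_(j : 'I_k * 'I_n)
     K i.1 j.1 * Y i.2 j.2 * (V i.1 i.2 * V j.1 j.2) =
  \sum_r \sum_s Y r s * (V^T *m K *m V) r s.
Proof.
rewrite -(pair_bigA _ (fun a r => \sum_(j : 'I_k * 'I_n)
  K a j.1 * Y r j.2 * (V a r * V j.1 j.2))) /= exchange_big.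
apply: eq_bigr => r _ /=.
transitivity (\sum_a \sum_b \sum_s K a b * Y r s * (V a r * V b s)).
  by apply: eq_bigr => a _; rewrite pair_bigA.
transitivity (\sum_s \sum_b \sum_a K a b * Y r s * (V a r * V b s)).
  rewrite exchange_big [RHS]exchange_big; apply: eq_bigr => b _ /=.
  exact: exchange_big.
apply: eq_bigr => s _; rewrite mxE mulr_sumr; apply: eq_bigr => b _.
rewrite mxE mulr_suml mulr_sumr; apply: eq_bigr => a _; rewrite mxE.
by ring.
Qed.

Section FormDuality.
Variables (F : fieldType) (k n : nat) (K : 'M[F]_k) (C : 'M[F]_n) (ka ep : F).
Hypothesis two0 : (2%:R : F) != 0.
Hypothesis trK : K^T = ka *: K.
Hypothesis trC : C^T = ep *: C.
Hypothesis kaep : ka * ep = -1.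
Hypothesis ka2 : ka * ka = 1.
Hypothesis KK : K *m K^T = 1%:M.
Hypothesis CC : C *m C^T = 1%:M.

Variables (A : algType F) (w : 'I_k * 'I_n -> A).
Hypothesis w_comm : forall i j,
  ad (w i) (w j) = (- (K i.1 j.1 * C i.2 j.2))%:A.

Definition dual_form (X : 'M[F]_n) (i j : 'I_k * 'I_n) : F :=
  K i.1 j.1 * (X *m C) i.2 j.2.

Definition dual_op (X : 'M[F]_n) : A := quad w (dual_form X).

Lemma form_defect0 X : form_defect C X = 0 -> C *m X^T = - (X *m C).
Proof.
have ep0 : ep != 0.
  by apply: contra_eq_neq kaep => ->; rewrite mulr0 eq_sym oppr_eq0 oner_eq0.
move=> /(congr1 (fun Z => C *m C^T *m (C^T *m Z *m C^T))).
rewrite /form_defect CC mul1mx mulmx0 mul0mx mulmx0.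
rewrite mulmxDr mulmxDl !mulmxA -[C^T *m X^T *m C *m C^T]mulmxA CC mulmx1.
rewrite (mulmx1C CC) mul1mx trC -scalemxAl -scalemxAr -scalerDr => /eqP.
by rewrite scaler_eq0 (negPf ep0) addr_eq0 => /eqP.
Qed.

Lemma trXC X : form_defect C X = 0 -> (X *m C)^T = ka *: (X *m C).
Proof.
move=> /form_defect0 XE; rewrite trmx_mul trC -scalemxAl XE scalerN -scaleNr.
congr (_ *: _); rewrite -[LHS]mul1r -ka2 -mulrA mulrN kaep opprK.
by rewrite mulr1.
Qed.

Lemma dual_form_sym X : form_defect C X = 0 ->
  forall i j, dual_form X j i = dual_form X i j.
Proof.
move=> /trXC XC [a r] [b s]; rewrite /dual_form /=.
by rewrite (tr_scale_entry r s XC) (tr_scale_entry a b trK) mulrACA ka2 mul1r.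
Qed.

Lemma dual_op_ad X i : form_defect C X = 0 ->
  ad (dual_op X) (w i) =
  \sum_j ((j.1 == i.1)%:R * X j.2 i.2) *: w j.
Proof.
move=> X0; rewrite (quad_ad w_comm two0 _ (dual_form_sym X0)) -sumrN.
apply: eq_bigr => j _; rewrite -scaleNr; congr (_ *: _).
rewrite -sumrN -(pair_bigA _ (fun b s =>
  - (K j.1 b * (X *m C) j.2 s * - (K i.1 b * C i.2 s)))) /=.
transitivity (\sum_b (K j.1 b * K^T b i.1) * \sum_s ((X *m C) j.2 s * C^T s i.2)).
  apply: eq_bigr => b _; rewrite mulr_sumr; apply: eq_bigr => s _.
  by rewrite mulrN opprK mulrACA !mxE.
rewrite -mulr_suml.
have -> : \sum_b K j.1 b * K^T b i.1 = (K *m K^T) j.1 i.1 by rewrite mxE.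
have -> : \sum_s (X *m C) j.2 s * C^T s i.2 = (X *m C *m C^T) j.2 i.2.
  by rewrite [RHS]mxE.
by rewrite KK -mulmxA CC mulmx1 mxE.
Qed.

Lemma dual_op_hom : is_lie_hom (fun X => form_defect C X = 0) dual_op.
Proof.
split=> [c X Y _ _|X Y X0 Y0].
  rewrite -quadP; apply: eq_quad => i j; rewrite /dual_form mulmxDl -scalemxAl.
  by rewrite !mxE mulrDr mulrCA.
rewrite -/(ad (dual_op X) (dual_op Y)).
rewrite (quad_deriv _ (fun i => dual_op_ad i X0)); apply: eq_quad => i j /=.
transitivity (\sum_l (i.1 == l.1)%:R * (X i.2 l.2 * (K l.1 j.1 * (Y *m C) l.2 j.2))
  + \sum_l (j.1 == l.1)%:R * (X j.2 l.2 * (K i.1 l.1 * (Y *m C) i.2 l.2))).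
  rewrite (sum_pair_delta (fun b s => X i.2 s * (K b j.1 * (Y *m C) s j.2))).
  rewrite (sum_pair_delta (fun b s => X j.2 s * (K i.1 b * (Y *m C) i.2 s))).
  rewrite /dual_form.
  have -> : (X *m Y - Y *m X) *m C = X *m (Y *m C) + Y *m C *m X^T.
    by rewrite mulmxBl -[Y *m C *m _]mulmxA (form_defect0 X0) mulmxN !mulmxA.
  rewrite [X in _ * X]mxE mulrDr; congr (_ + _).
    by rewrite mxE mulr_sumr; apply: eq_bigr => s _; rewrite mulrCA.
  rewrite mxE mulr_sumr; apply: eq_bigr => s _.
  by rewrite [X^T _ _]mxE mulrA mulrC.
by congr (_ + _); apply: eq_bigr => l _; rewrite /dual_form mulrA.
Qed.

Hypothesis gram : forall S : 'M[F]_n, S^T = ka *: S ->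
  exists V : 'M[F]_(k, n), V^T *m K *m V = S.

Lemma dual_op_symbol (G : 'M[F]_n) : exists y : A,
  forall X, form_defect C X = 0 ->
  has_symbol y 2 (dual_op X) (\sum_r \sum_s X r s * G r s).
Proof.
pose H := G *m C.
have [|V VE] := gram (S := H + ka *: H^T).
  by rewrite linearD linearZ /= trmxK scalerDr scalerA ka2 scale1r addrC.
pose Y := - (K *m V *m C^T).
exists (\sum_i Y i.1 i.2 *: w i) => X X0.
have yw i : has_symbol (\sum_i Y i.1 i.2 *: w i) 1 (w i) (V i.1 i.2).
  apply: ad_symbol1; rewrite (ad_lincomb w_comm); congr (_ *: _).
  transitivity ((K^T *m (K *m V *m C^T) *m C) i.1 i.2); last first.
    by rewrite !mulmxA (mulmx1C KK) mul1mx -mulmxA (mulmx1C CC) mulmx1.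
  rewrite -mulmxA mxE -(pair_bigA _ (fun b s => Y b s * - (K b i.1 * C s i.2))) /=.
  apply: eq_bigr => b _; rewrite [X in _ * X]mxE mulr_sumr; apply: eq_bigr => s _.
  by rewrite /Y mulrN [X in X * _]mxE mulNr opprK [in RHS]mxE mulrCA mulrA.
have -> : \sum_r \sum_s X r s * G r s =
  2^-1 * \sum_i \sum_j dual_form X i j * (V i.1 i.2 * V j.1 j.2); last first.
  exact: quad_symbol.
rewrite sum_congruence VE !pairing_tr mulmxDr mxtraceD -scalemxAr mxtraceZ.
have -> : \tr ((X *m C)^T *m H^T) = ka * \tr ((X *m C)^T *m H).
  rewrite -trmx_mul mxtrace_tr mxtrace_mulC trXC // -scalemxAl mxtraceZ.
  by rewrite mulrA ka2 mul1r.
rewrite [ka * (ka * _)]mulrA ka2 mul1r.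
rewrite (_ : forall t : F, t + t = 2%:R * t); last by move=> t; ring.
rewrite mulrA mulVf // mul1r.
by rewrite trmx_mul -mulmxA [RHS]mxtrace_mulC /H -!mulmxA CC mulmx1.
Qed.

End FormDuality.

Section GLDuality.
Variables (F : fieldType) (n k : nat) (A : algType F).
Variables (z d : 'I_k -> 'I_n -> A).
Hypothesis zz : forall a r b s, ad (z a r) (z b s) = 0.
Hypothesis dd : forall a r b s, ad (d a r) (d b s) = 0.
Hypothesis dz : forall a r b s,
  ad (d a r) (z b s) = ((a == b) && (r == s))%:R%:A.

Definition gl_op (X : 'M[F]_n) : A :=
  \sum_r \sum_s X r s *: \sum_al z al r * d al s.

Lemma sum_delta2 (V : lmodType F) (f : 'I_k -> 'I_n -> V) b t :
  \sum_al \sum_s ((al == b) && (s == t))%:R *: f al s = f b t.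
Proof.
rewrite (bigD1 b) //= (bigD1 t) //= !eqxx scale1r.
rewrite [X in _ + X + _]big1 => [|s st]; last by rewrite (negPf st) scale0r.
rewrite big1 ?addr0 // => al alb; apply: big1 => s _.
by rewrite (negPf alb) scale0r.
Qed.

Lemma gl_op_ad_z X b t : ad (gl_op X) (z b t) = \sum_r X r t *: z b r.
Proof.
rewrite adC ad_sum -sumrN; apply: eq_bigr => r _; rewrite ad_sum -sumrN.
rewrite -(sum_delta2 (fun al s => X r s *: z al r) b t) exchange_big.
apply: eq_bigr => s _ /=; rewrite adZ ad_sum -scalerN -sumrN scaler_sumr.
apply: eq_bigr => al _; rewrite adM zz mul0r add0r adC dz mulrN opprK mulr_algr.
by rewrite !scalerA mulrC.
Qed.

Lemma gl_op_ad_d X b t : ad (gl_op X) (d b t) = - \sum_s X t s *: d b s.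
Proof.
rewrite adC ad_sum; congr (- _).
rewrite -(sum_delta2 (fun al r => \sum_s X r s *: d al s) b t) exchange_big.
apply: eq_bigr => r _ /=; rewrite ad_sum; under [RHS]eq_bigr do rewrite scaler_sumr.
rewrite exchange_big; apply: eq_bigr => s _ /=; rewrite adZ ad_sum scaler_sumr.
apply: eq_bigr => al _; rewrite adM dd mulr0 addr0 dz mulr_algl.
by rewrite !scalerA mulrC [b == al]eq_sym [t == r]eq_sym.
Qed.

Lemma gl_op_hom : is_lie_hom (gl F n) gl_op.
Proof.
split=> [c X Y _ _|X Y _ _].
  rewrite /gl_op scaler_sumr -big_split; apply: eq_bigr => r _ /=.
  rewrite scaler_sumr -big_split; apply: eq_bigr => s _ /=.
  by rewrite !mxE scalerDl scalerA.
pose E t u := \sum_al z al t * d al u.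
have adE t u : ad (gl_op X) (E t u) = \sum_r X r t *: E r u - \sum_s X u s *: E t s.
  rewrite ad_sum; under [X in _ = X - _]eq_bigr do rewrite scaler_sumr.
  under [X in _ = _ - X]eq_bigr do rewrite scaler_sumr.
  rewrite exchange_big [X in _ = _ - X]exchange_big -sumrB; apply: eq_bigr => al _ /=.
  rewrite adM gl_op_ad_z gl_op_ad_d mulrN mulr_suml mulr_sumr.
  by congr (_ - _); apply: eq_bigr => r _; rewrite -?scalerAl -?scalerAr.
rewrite -/(ad (gl_op X) (gl_op Y)) [in RHS]/gl_op ad_sum.
transitivity (\sum_t \sum_u \sum_r (X r t * Y t u) *: E r u
  - \sum_t \sum_u \sum_s (Y t u * X u s) *: E t s); last first.
  rewrite -sumrB; apply: eq_bigr => t _; rewrite ad_sum -sumrB.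
  apply: eq_bigr => u _; rewrite adZ adE scalerBr !scaler_sumr.
  by congr (_ - _); apply: eq_bigr => r _; rewrite scalerA // mulrC.
transitivity (gl_op (X *m Y) - gl_op (Y *m X)).
  rewrite -sumrB; apply: eq_bigr => r _; rewrite -sumrB; apply: eq_bigr => s _.
  by rewrite !mxE scalerBl.
congr (_ - _).
  under [RHS]eq_bigr do rewrite exchange_big.
  rewrite [RHS]exchange_big; apply: eq_bigr => r _ /=.
  rewrite [RHS]exchange_big; apply: eq_bigr => u _ /=.
  by rewrite mxE scaler_suml.
apply: eq_bigr => t _; rewrite [RHS]exchange_big; apply: eq_bigr => s _ /=.
by rewrite mxE scaler_suml.
Qed.

Lemma gl_op_symbol (G : 'M[F]_n) : (n <= k)%N -> exists y : A,
  forall X, gl F n X ->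
  has_symbol y 2 (gl_op X) (\sum_r \sum_s X r s * G r s).
Proof.
move=> nk; pose Z (al : 'I_k) (r : 'I_n) : F := (al == widen_ord nk r)%:R.
pose D (al : 'I_k) (s : 'I_n) : F := \sum_r Z al r * G r s.
have ZD r s : \sum_al Z al r * D al s = G r s.
  rewrite (bigD1 (widen_ord nk r)) //= {1}/Z eqxx mul1r big1 ?addr0; last first.
    by move=> al alr; rewrite /Z (negPf alr) mul0r.
  rewrite /D (bigD1 r) //= {1}/Z eqxx mul1r big1 ?addr0 // => r' r'r.
  rewrite /Z -val_eqE /= val_eqE eq_sym (negPf r'r) mul0r //.
pose y := \sum_al \sum_r (Z al r *: d al r - D al r *: z al r).
have yE x : ad y x = \sum_al \sum_r (Z al r *: ad (d al r) x - D al r *: ad (z al r) x).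
  rewrite adC ad_sum -sumrN; apply: eq_bigr => al _.
  rewrite ad_sum -sumrN; apply: eq_bigr => r _.
  by rewrite -scaleNr adD !adZ opprD -!scalerN -!adC scaleNr [ad x _]adC scalerN.
have yz b t : has_symbol y 1 (z b t) (Z b t).
  apply: ad_symbol1; rewrite yE -(sum_delta2 (fun al r => (Z al r)%:A) b t).
  apply: eq_bigr => al _; apply: eq_bigr => r _.
  by rewrite zz scaler0 subr0 dz !scalerA mulrC.
have yd b t : has_symbol y 1 (d b t) (D b t).
  apply: ad_symbol1; rewrite yE -(sum_delta2 (fun al r => (D al r)%:A) b t).
  apply: eq_bigr => al _; apply: eq_bigr => r _.
  rewrite dd scaler0 add0r adC dz scalerN opprK !scalerA mulrC.
  by rewrite [b == al]eq_sym [t == r]eq_sym.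
exists y => X _; apply: has_symbol_sum => r _; apply: has_symbol_sum => s _.
apply: has_symbolZ; rewrite -ZD; apply: has_symbol_sum => al _.
exact: (has_symbolM (yz al r) (yd al s)).
Qed.

End GLDuality.

Section CoordinateOperators.
Variables (F : fieldType) (T : finType).

Program Definition xlin (t : T) : linop (pol F T) := @LinOp _ _ (@xop F T t) _.
Next Obligation. by move=> t c u v; rewrite /xop mulrDr scalerAr. Qed.
Program Definition dlin (t : T) : linop (pol F T) := @LinOp _ _ (@dop F T t) _.
Next Obligation. by move=> t c u v; rewrite /dop linearP. Qed.

Lemma ad_xlin s t : ad (xlin s) (xlin t) = 0.
Proof.
by apply/eqP; rewrite subr_eq0; apply/eqP/linopP => p; exact: mulrCA.
Qed.

Lemma ad_dlin s t : ad (dlin s) (dlin t) = 0.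
Proof.
by apply/eqP; rewrite subr_eq0; apply/eqP/linopP => p; exact: mderiv_comm.
Qed.

Lemma ad_dlin_xlin s t : ad (dlin s) (xlin t) = (s == t)%:R%:A.
Proof.
apply/eqP; rewrite subr_eq; apply/eqP/linopP => p.
rewrite linopD linopZ !linopM /= /dop /xop mderivM; congr (_ + _).
rewrite mderivX mnm1E (inj_eq enum_rank_inj) [t == s]eq_sym.
have [->|st] := eqVneq s t; last by rewrite !scale0r mul0r.
have -> : (U_(enum_rank t) - U_(enum_rank t))%MM = 0%MM.
  by apply/mnmP => i; rewrite mnmBE subnn mnm0E.
by rewrite !scale1r mpolyX0 mul1r.
Qed.

Lemma ad_xlin_dlin s t : ad (xlin s) (dlin t) = (- (s == t)%:R)%:A.
Proof. by rewrite adC ad_dlin_xlin scaleNr eq_sym. Qed.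

End CoordinateOperators.

(** * The three dual pairs *)

Lemma split_lshift m n (i : 'I_m) : split (lshift n i) = inl i.
Proof. exact: (unsplitK (inl i)). Qed.

Lemma split_rshift m n (i : 'I_n) : split (rshift m i) = inr i.
Proof. exact: (unsplitK (inr i)). Qed.

Section CaseA.
Variables (F : fieldType) (p q k : nat).

Definition zAlin (al : 'I_k) (r : 'I_(p + q)) : linop (pol F (VA p q k)) :=
  match split r with
  | inl i => dlin F (inl (al, i) : VA p q k)
  | inr j => xlin F (inr (al, j) : VA p q k)
  end.

Definition dzAlin (al : 'I_k) (r : 'I_(p + q)) : linop (pol F (VA p q k)) :=
  match split r with
  | inl i => - xlin F (inl (al, i) : VA p q k)
  | inr j => dlin F (inr (al, j) : VA p q k)
  end.

Lemma phiA_gl_op X : phiA F p q k X =1 gl_op zAlin dzAlin X.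
Proof.
move=> f; rewrite /phiA /gl_op linop_sum; apply: eq_bigr => r _.
rewrite linop_sum; apply: eq_bigr => s _; rewrite linopZ linop_sum.
congr (_ *: _); apply: eq_bigr => al _; rewrite linopM.
by rewrite /zA /dzA /zAlin /dzAlin; case: (split r) => ?; case: (split s).
Qed.

Lemma adNl (A : algType F) (x y : A) : ad (- x) y = - ad x y.
Proof. by rewrite /ad mulNr mulrN opprK opprB addrC. Qed.

Lemma adNr (A : algType F) (x y : A) : ad x (- y) = - ad x y.
Proof. by rewrite /ad mulNr mulrN opprK opprB addrC. Qed.

Lemma zAlin_comm a r b s : ad (zAlin a r) (zAlin b s) = 0.
Proof.
rewrite /zAlin; case: (split r) => i; case: (split s) => j;
by rewrite ?ad_dlin ?ad_xlin ?ad_dlin_xlin ?ad_xlin_dlin ?oppr0 ?scale0r.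
Qed.

Lemma dzAlin_comm a r b s : ad (dzAlin a r) (dzAlin b s) = 0.
Proof.
rewrite /dzAlin; case: (split r) => i; case: (split s) => j;
by rewrite ?adNl ?adNr ?ad_dlin ?ad_xlin ?ad_dlin_xlin ?ad_xlin_dlin ?scale0r ?oppr0
  ?scale0r ?oppr0.
Qed.

Lemma dzAlin_zAlin a r b s :
  ad (dzAlin a r) (zAlin b s) = ((a == b) && (r == s))%:R%:A.
Proof.
rewrite /dzAlin /zAlin; case: (split_ordP r) => i ->; case: (split_ordP s) => j ->;
rewrite ?split_lshift ?split_rshift ?adNl ?ad_dlin ?ad_xlin ?ad_dlin_xlin ?ad_xlin_dlin.
- by rewrite scaleNr opprK (inj_eq (@lshift_inj _ _)).
- by rewrite eq_lrshift andbF scale0r oppr0.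
- by rewrite eq_rlshift andbF scale0r.
- by rewrite (inj_eq (@rshift_inj _ _)).
Qed.

Lemma U_injective_phiA : [pchar F] =i pred0 -> (p + q <= k)%N ->
  U_injective (gl F (p + q)) (phiA F p q k).
Proof.
move=> F0 pqk; apply: (@U_injective_symbol _ _ _ _ fullv _ (gl_op zAlin dzAlin)) => //.
- by move=> X; rewrite memvf; split.
- by move=> X Y _ _; rewrite memvf.
- exact: phiA_gl_op.
- exact: gl_op_hom zAlin_comm dzAlin_comm dzAlin_zAlin.
- move=> G; exact: gl_op_symbol zAlin_comm dzAlin_comm dzAlin_zAlin _ _.
Qed.

End CaseA.

Section CaseB.
Variables (F : closedFieldType) (n k : nat).

Definition wBlin (i : 'I_k * 'I_(n + n)) : linop (pol F (VB n k)) :=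
  match split i.2 with
  | inl r => xlin F ((i.1, r) : VB n k)
  | inr r => dlin F ((i.1, r) : VB n k)
  end.

Lemma wBlin_comm i j :
  ad (wBlin i) (wBlin j) = (- ((1%:M : 'M[F]_k) i.1 j.1 * Jsp F n i.2 j.2))%:A.
Proof.
case: i j => [a r] [b s]; rewrite /wBlin /Jsp /=.
case: (split_ordP r) => i ->; case: (split_ordP s) => j ->;
rewrite ?split_lshift ?split_rshift ?ad_dlin ?ad_xlin ?ad_dlin_xlin ?ad_xlin_dlin;
rewrite ?block_mxEul ?block_mxEur ?block_mxEdl ?block_mxEdr !mxE.
- by rewrite mulr0 oppr0 scale0r.
- by rewrite -natrM mulnb.
- by rewrite mulrN opprK -natrM mulnb.
- by rewrite mulr0 oppr0 scale0r.
Qed.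

Lemma phiB_dual_op X : phiB F n k X =1 dual_op 1%:M (Jsp F n) wBlin X.
Proof.
move=> f; rewrite /phiB /dual_op /quad linopZ; congr (_ *: _).
rewrite linop_sum -(pair_bigA _ (fun al a =>
  (\sum_j dual_form 1%:M (Jsp F n) X (al, a) j *: (wBlin (al, a) * wBlin j)) f)) /=.
apply: eq_bigr => al _; apply: eq_bigr => a _; rewrite linop_sum.
rewrite -(pair_bigA _ (fun be b => (dual_form 1%:M (Jsp F n) X (al, a) (be, b) *:
  (wBlin (al, a) * wBlin (be, b))) f)) /= (bigD1 al) //= [X in _ = _ + X]big1.
  rewrite addr0; apply: eq_bigr => b _; rewrite /dual_form /= !mxE.
  rewrite eqxx mul1r; congr (_ *: _); rewrite /wB /wBlin /=.
  by case: (split a) => ?; case: (split b).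
move=> be beal; apply: big1 => b _; rewrite /dual_form /= mxE eq_sym.
by rewrite (negPf beal) mul0r scale0r.
Qed.

Lemma U_injective_phiB : [pchar F] =i pred0 -> (n <= k./2)%N ->
  U_injective (sp F n) (phiB F n k).
Proof.
move=> F0 nk; have two0 : (2%:R : F) != 0 by rewrite (pcharf0P _).1.
have trK : (1%:M : 'M[F]_k)^T = 1 *: 1%:M by rewrite trmx1 scale1r.
have trC : (Jsp F n)^T = -1 *: Jsp F n.
  rewrite /Jsp tr_block_mx linearN /= !trmx1 !trmx0 scaleN1r opp_block_mx.
  by rewrite !oppr0 opprK.
have kaep : 1 * -1 = -1 :> F by rewrite mul1r.
have ka2 : 1 * 1 = 1 :> F by rewrite mul1r.
have KK : 1%:M *m (1%:M : 'M[F]_k)^T = 1%:M by rewrite trmx1 mul1mx.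
have CC : Jsp F n *m (Jsp F n)^T = 1%:M.
  rewrite trC /Jsp scaleN1r opp_block_mx mulmx_block !oppr0 !mulmx0 !mul0mx opprK.
  by rewrite !addr0 !add0r !mulmx1 mulmxN mulNmx mulmx1 opprK -scalar_mx_block.
apply: (@U_injective_symbol _ _ _ _ (form_algebra (Jsp F n)) _
         (dual_op 1%:M (Jsp F n) wBlin)) => //.
- exact: form_algebraP.
- exact: form_algebra_lie.
- exact: phiB_dual_op.
- exact: (dual_op_hom two0 trK trC kaep ka2 KK CC wBlin_comm).
- move=> G; refine (dual_op_symbol two0 trC kaep ka2 KK CC wBlin_comm _ G).
  move=> S; rewrite scale1r => Ssym; have Sk : (\rank S <= k)%N.
    by apply: leq_trans (rank_leq_row S) _; lia.
  by have [V VE] := sym_gram two0 Ssym Sk; exists V; rewrite mulmx1.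
Qed.

End CaseB.

Section CaseC.
Variables (F : closedFieldType) (n k : nat).

Definition wClin (i : 'I_(k + k) * 'I_(n + n)) : linop (pol F (VC n k)) :=
  match split i.2 with
  | inl r => xlin F ((i.1, r) : VC n k)
  | inr r => \sum_be (- omega F k) i.1 be *: dlin F ((be, r) : VC n k)
  end.

Lemma tr_omega : (omega F k)^T = -1 *: omega F k.
Proof.
rewrite /omega tr_block_mx linearN /= !trmx1 !trmx0 scaleN1r opp_block_mx.
by rewrite !oppr0 opprK.
Qed.

Lemma ad_dlin_sum (a : 'I_(k + k)) (i : 'I_n) b j :
  ad (\sum_be (- omega F k) a be *: dlin F ((be, i) : VC n k))
     (xlin F ((b, j) : VC n k)) = (- (omega F k a b * (i == j)%:R))%:A.
Proof.
rewrite adC ad_sum -sumrN (bigD1 b) //= big1 => [|be beb].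
  rewrite addr0 adZ -scalerN -adC ad_dlin_xlin xpair_eqE eqxx /= scalerA.
  by rewrite mxE mulNr.
by rewrite adZ -scalerN -adC ad_dlin_xlin xpair_eqE (negPf beb) scale0r scaler0.
Qed.

Lemma wClin_comm i j :
  ad (wClin i) (wClin j) = (- (omega F k i.1 j.1 * Theta F n i.2 j.2))%:A.
Proof.
case: i j => [a r] [b s]; rewrite /wClin /Theta /=.
case: (split_ordP r) => i ->; case: (split_ordP s) => j ->;
rewrite ?split_lshift ?split_rshift;
rewrite ?block_mxEul ?block_mxEur ?block_mxEdl ?block_mxEdr [X in omega F k _ _ * X]mxE.
- by rewrite ad_xlin mulr0 oppr0 scale0r.
- rewrite adC ad_dlin_sum eq_sym (tr_scale_entry a b tr_omega).
  by rewrite -scaleNr mulN1r mulNr opprK.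
- exact: ad_dlin_sum.
- rewrite mulr0 oppr0 scale0r ad_sum big1 // => be _; rewrite adZ adC ad_sum.
  by rewrite big1 ?oppr0 ?scaler0 // => ga _; rewrite adZ ad_dlin scaler0.
Qed.

Lemma phiC_dual_op X : phiC F n k X =1 dual_op (omega F k) (Theta F n) wClin X.
Proof.
have wE i g : wC i.1 i.2 g = wClin i g.
  rewrite /wC /wClin; case: (split i.2) => // r; rewrite linop_sum.
  by apply: eq_bigr => be _; rewrite linopZ.
move=> f; rewrite /phiC /dual_op /quad linopZ; congr (_ *: _).
rewrite linop_sum -(pair_bigA _ (fun al a => (\sum_j
  dual_form (omega F k) (Theta F n) X (al, a) j *: (wClin (al, a) * wClin j)) f)) /=.
apply: eq_bigr => al _; under eq_bigr do rewrite scaler_sumr.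
rewrite exchange_big; apply: eq_bigr => a _ /=; rewrite linop_sum.
rewrite -(pair_bigA _ (fun be b => (dual_form (omega F k) (Theta F n) X
  (al, a) (be, b) *: (wClin (al, a) * wClin (be, b))) f)) /=.
apply: eq_bigr => be _; rewrite scaler_sumr; apply: eq_bigr => b _.
by rewrite -!wE scalerA.
Qed.

Lemma U_injective_phiC : [pchar F] =i pred0 -> (n <= k)%N ->
  U_injective (so F n) (phiC F n k).
Proof.
move=> F0 nk; have two0 : (2%:R : F) != 0 by rewrite (pcharf0P _).1.
have trC : (Theta F n)^T = 1 *: Theta F n.
  by rewrite /Theta tr_block_mx !trmx1 !trmx0 scale1r.
have kaep : -1 * 1 = -1 :> F by rewrite mulr1.
have ka2 : -1 * -1 = 1 :> F by rewrite mulrNN mulr1.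
have KK : omega F k *m (omega F k)^T = 1%:M.
  rewrite tr_omega /omega scaleN1r opp_block_mx mulmx_block !oppr0 !mulmx0 !mul0mx.
  by rewrite opprK !addr0 !add0r !mulmx1 mulmxN mulNmx mulmx1 opprK -scalar_mx_block.
have CC : Theta F n *m (Theta F n)^T = 1%:M.
  rewrite trC /Theta scale1r mulmx_block !mulmx0 !mul0mx.
  by rewrite !addr0 !add0r !mulmx1 -scalar_mx_block.
apply: (@U_injective_symbol _ _ _ _ (form_algebra (Theta F n)) _
         (dual_op (omega F k) (Theta F n) wClin)) => //.
- exact: form_algebraP.
- exact: form_algebra_lie.
- exact: phiC_dual_op.
- exact: (dual_op_hom two0 tr_omega trC kaep ka2 KK CC wClin_comm).
- move=> G; refine (dual_op_symbol two0 trC kaep ka2 KK CC wClin_comm _ G).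
  move=> S; rewrite scaleN1r => Salt; apply: alt_gram => //.
  by apply: leq_trans (rank_leq_row S) _; lia.
Qed.

End CaseC.

(* rank gl_{p+q} = p+q, rank GL_k = k;  rank sp_{2n} = n, rank O_k = k/2 (floor);
   rank so_{2n} = n, rank Sp_{2k} = k. *)
Theorem mainTheorem19 (F : closedFieldType) (hchar : [pchar F] =i pred0) :
  (forall p q k : nat, (p + q <= k)%N ->
     U_injective (gl F (p + q)) (phiA F p q k))
  /\ (forall n k : nat, (n <= k./2)%N ->
     U_injective (sp F n) (phiB F n k))
  /\ (forall n k : nat, (n <= k)%N ->
     U_injective (so F n) (phiC F n k)).
Proof.
split; last split => n k nk.
- by move=> p q k pqk; exact: U_injective_phiA.
- exact: U_injective_phiB.
- exact: U_injective_phiC.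
Qed.
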